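(* Let $f,h_1,\dots,h_s:\mathbb{R}^n\to\mathbb{R}$ be convex and twice differentiable, let $g_1,\dots,g_r:\mathbb{R}^n\to\mathbb{R}$ be affine, and for $\rho\ge 0$ let $$\mathcal{E}_\rho(y)=f(y)+\rho\sum_{i=1}^r|g_i(y)|+\rho\sum_{j=1}^s\max\{0,h_j(y)\}.$$ Let $I\subseteq[0,\infty)$ be an interval such that $\mathcal{E}_\rho$ is strictly convex and coercive for every $\rho\in I$. Then for every $\rho\in I$ the (unique) minimizer $x(\rho)$ of $\mathcal{E}_\rho$ exists, and the solution path $\rho\mapsto x(\rho)$ is continuous on $I$. Furthermore, if $\rho\in I$, $\rho>0$, and the gradient vectors $$\{\nabla g_i(x): g_i(x)=0\}\cup\{\nabla h_j(x):h_j(x)=0\}$$ of the active constraints are linearly independent at $x=x(\rho)$, then the coefficients $s_i(\rho)$ and $t_j(\rho)$ ($1\le i\le r$, $1\le j\le s$) are unique and continuous near $\rho$ (that is, on some neighborhood of $\rho$ in $I$) as well.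
   Context: The setting is the convex program of minimizing $f(x)$ subject to the affine equality constraints $g_i(x)=0$ and the convex inequality constraints $h_j(x)\le 0$; $\mathcal{E}_\rho$ is its exact penalty surrogate. A function is coercive if it tends to $+\infty$ as $\|y\|\to\infty$. A constraint is active at $x$ if $g_i(x)=0$, respectively $h_j(x)=0$; linear independence is that of the family of gradients indexed by the active constraints. The coefficients $s_i(\rho),t_j(\rho)$ are real numbers for which, with $x=x(\rho)$, the stationarity condition $$\mathbf{0}=\nabla f(x)+\rho\sum_{i=1}^r s_i(\rho)\nabla g_i(x)+\rho\sum_{j=1}^s t_j(\rho)\nabla h_j(x)$$ holds, subject to $s_i(\rho)=-1$ if $g_i(x)<0$, $s_i(\rho)\in[-1,1]$ if $g_i(x)=0$, $s_i(\rho)=1$ if $g_i(x)>0$, and $t_j(\rho)=0$ if $h_j(x)<0$, $t_j(\rho)\in[0,1]$ if $h_j(x)=0$, $t_j(\rho)=1$ if $h_j(x)>0$. *)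

(* Defs.v *)
From mathcomp Require Import all_boot all_order all_algebra.
From mathcomp Require Import all_classical all_reals all_analysis.

Set Implicit Arguments.
Unset Strict Implicit.
Unset Printing Implicit Defensive.

Import Order.TTheory GRing.Theory Num.Theory.
Import numFieldNormedType.Exports.

Local Open Scope classical_set_scope.
Local Open Scope ring_scope.

Section functions.
Context {R : realType} {n : nat}.
Implicit Types (f : 'rV[R]_n -> R) (x y : 'rV[R]_n).

Definition gradient f x : 'rV[R]_n := \row_i 'D_(delta_mx 0 i) f x.

(* Existence of the partial derivatives does not imply differentiability, so
   Frechet differentiability of [f] is required in addition to that of its
   gradient. *)
Definition twice_differentiable f :=
  (forall x, differentiable f x) /\ (forall x, differentiable (gradient f) x).

Definition affine_function f :=
  exists (a : 'cV[R]_n) (b : R), forall y, f y = (y *m a) 0 0 + b.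

Definition strictly_convex f :=
  forall x y (t : R), x != y -> 0 < t < 1 ->
    f (t *: x + (1 - t) *: y) < t * f x + (1 - t) * f y.

(* The norm is the library's supremum norm on row vectors; all norms on R^n
   give the same notion. *)
Definition coercive f :=
  forall A : R, exists M : R, forall y, M < `|y| -> A < f y.

Definition minimizer f x := forall y, f x <= f y.

End functions.

Section penalty.
Context {R : realType} {n r s : nat}.
Variables (f : 'rV[R]_n -> R).
Variables (g : 'I_r -> 'rV[R]_n -> R) (h : 'I_s -> 'rV[R]_n -> R).

Definition penalized (rho : R) (y : 'rV[R]_n) : R :=
  f y + rho * \sum_(i < r) `|g i y| + rho * \sum_(j < s) Num.max 0 (h j y).

(* A sequence rather than a set, so that two active constraints with the same
   gradient make the family dependent. *)
Definition active_gradients (x : 'rV[R]_n) : seq 'rV[R]_n :=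
  [seq gradient (g i) x | i <- enum 'I_r & g i x == 0] ++
  [seq gradient (h j) x | j <- enum 'I_s & h j x == 0].

Definition eq_coefficient (v c : R) :=
  [/\ v < 0 -> c = -1, v = 0 -> -1 <= c <= 1 & 0 < v -> c = 1].

Definition ineq_coefficient (v c : R) :=
  [/\ v < 0 -> c = 0, v = 0 -> 0 <= c <= 1 & 0 < v -> c = 1].

Definition stationarity_coefficients (rho : R) (x : 'rV[R]_n)
    (sigma : 'rV[R]_r) (tau : 'rV[R]_s) :=
  [/\ 0 = gradient f x
          + rho *: (\sum_(i < r) sigma 0 i *: gradient (g i) x)
          + rho *: (\sum_(j < s) tau 0 j *: gradient (h j) x),
      forall i, eq_coefficient (g i x) (sigma 0 i)
    & forall j, ineq_coefficient (h j x) (tau 0 j)].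

End penalty.

(* Main.v *)
(* A minimizer exists by coercivity and is unique by strict convexity. If
   [x q] stayed at distance e from [x rho] as q tends to rho, convexity would
   provide a point of the sphere of radius e around [x rho] at which E_q is at
   most [E_q (x rho)]; compactness of the sphere and uniform closeness of E_q
   and E_rho on it exclude this.

   When the active gradients are independent, take vectors [D k] dual to them.
   The one-sided directional derivatives of E_rho at its minimizer are
   nonnegative, which forces the smooth part of the gradient into the span of
   the active gradients; the directions +-[D k] bound its coefficients.
   Independence persists near rho because inactive constraints stay inactive and
   the pairings of the gradients with the [D k] move continuously. *)
Require Import Defs.
From mathcomp Require Import all_boot all_order all_algebra.
From mathcomp Require Import all_classical all_reals all_analysis.
From mathcomp Require Import ring lra.

Set Implicit Arguments.
Unset Strict Implicit.
Unset Printing Implicit Defensive.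

Import Order.TTheory GRing.Theory Num.Theory.
Import numFieldNormedType.Exports.

Local Open Scope classical_set_scope.
Local Open Scope ring_scope.

(** * Existence, uniqueness and continuity of minimizers *)

Lemma norm_sub_continuous {R : numFieldType} {V : normedModType R} (a : V) :
  continuous (fun y : V => `|y - a|).
Proof. by move=> y; apply: cvg_norm; apply: cvgB => //; exact: cvg_cst. Qed.

Lemma continuous_penalty {R : numFieldType} {T : topologicalType}
    (f P : T -> R) (rho : R) :
  continuous f -> continuous P -> continuous (fun y => f y + rho * P y).
Proof.
move=> fc Pc y; apply: cvgD; first exact: fc.
by apply: cvgM; [exact: cvg_cst|exact: Pc].
Qed.

Section minimizers.
Context {R : realType} {n : nat}.
Implicit Types (F f P : 'rV[R]_n -> R) (x y : 'rV[R]_n).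

(** The sublevel set at the value [F 0] is closed by continuity and bounded by coercivity, hence
    compact. A minimum over it is global, since [F] exceeds [F 0] elsewhere. *)
Lemma coercive_minimizer F :
  continuous F -> coercive F -> exists x, minimizer F x.
Proof.
move=> Fc /(_ (F 0))[M FM].
have bA : bounded_set [set y | F y <= F 0].
  exists M; split; first exact: num_real.
  move=> N MN y /= Fy; rewrite leNgt; apply/negP => Ny.
  by have := lt_le_trans (FM _ (lt_trans MN Ny)) Fy; rewrite ltxx.
have cA : closed [set y | F y <= F 0].
  apply: (@closed_comp _ _ F [set a | a <= F 0]); last exact: closed_le.
  by move=> y _; exact: Fc.
have [||c cA' cmin] :=
  EVT_min_rV (f := F) _ (bounded_closed_compact bA cA) _.
- by exists 0 => /=.
- exact: continuous_subspaceT.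
rewrite inE/= in cA'; exists c => y.
have [Fy|/ltW Fy] := leP (F y) (F 0); first by apply: cmin; rewrite inE.
exact: le_trans Fy.
Qed.

Lemma strictly_convex_minimizer_unique F x y :
  strictly_convex F -> minimizer F x -> minimizer F y -> x = y.
Proof.
move=> Fcv Fx Fy; apply/eqP/negPn/negP => xy.
(* The midpoint of two distinct minimizers would have a strictly smaller value. *)
have t01 : 0 < (2^-1 : R) < 1 by lra.
have := Fcv x y 2^-1 xy t01.
by have := Fx (2^-1 *: x + (1 - 2^-1) *: y); have := Fy x; lra.
Qed.

(** Moving from [y] towards a point with no larger value does not increase [F]. The endpoint [t = 1]
    is included because [x q] may itself lie on the sphere used below. *)
Lemma strictly_convex_segment F x y (t : R) :
  strictly_convex F -> x != y -> 0 < t <= 1 -> F x <= F y ->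
  F (t *: x + (1 - t) *: y) <= F y.
Proof.
move=> Fcv xy /andP[t0]; rewrite le_eqVlt => /predU1P[->|t1] Fxy.
  by rewrite scale1r subrr scale0r addr0.
have := Fcv x y t xy; rewrite t0 t1 => /(_ isT)/ltW/le_trans; apply.
have : t * F x <= t * F y by rewrite ler_pM2l.
lra.
Qed.

Lemma minimizer_path_continuous f P (I : set R) (x : R -> 'rV[R]_n) :
  continuous f -> continuous P ->
  (forall q, I q -> strictly_convex (fun y => f y + q * P y)) ->
  (forall q, I q -> minimizer (fun y => f y + q * P y) (x q)) ->
  {within I, continuous x}.
Proof.
move=> fc Pc Ecv xmin; apply/subspace_continuousP => rho Irho.
apply/cvgrPdist_lt => e e0.
set x0 := x rho.
pose S : set 'rV[R]_n := [set y | `|y - x0| = e].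
have step q : I q -> e <= `|x0 - x q| ->
    exists2 z, S z & f z + q * P z <= f x0 + q * P x0.
  move=> Iq exq; set d := `|x q - x0|.
  have ed : e <= d by rewrite /d distrC.
  have d0 : 0 < d by exact: lt_le_trans ed.
  (* The point where the segment from [x0] to [x q] crosses the sphere of radius [e]. *)
  exists ((e / d) *: x q + (1 - e / d) *: x0).
    rewrite /S/=.
    have -> : e / d *: x q + (1 - e / d) *: x0 - x0 = (e / d) *: (x q - x0).
      by rewrite scalerBl scale1r scalerBr addrA addrAC addrK.
    by rewrite normrZ gtr0_norm ?divr_gt0// -/d divfK// gt_eqF.
  apply: (strictly_convex_segment (F := fun y => f y + q * P y)).
  - exact: Ecv.
  - by rewrite -subr_eq0 -normr_gt0.
  - by rewrite divr_gt0//= ler_pdivrMr// mul1r.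
  - exact: (xmin q Iq).
(* The sphere is empty when [n = 0]; the extreme value theorem needs it nonempty. *)
have [S0|S0] := pselect (S !=set0); last first.
  near=> q; rewrite ltNge; apply/negP => exq.
  have Iq : I q by near: q; exact: withinT.
  by have [z Sz _] := step _ Iq exq; apply: S0; exists z.
have nc : continuous (fun y : 'rV[R]_n => `|y - x0|).
  exact: norm_sub_continuous.
have Scomp : compact S.
  apply: bounded_closed_compact.
    exists (e + `|x0|); split; first exact: num_real.
    move=> N MN y /= Sy; apply: le_trans (ltW MN).
    by rewrite -[y in `|y|](subrK x0) -Sy; exact: ler_normD.
  apply: (@closed_comp _ _ (fun y : 'rV[R]_n => `|y - x0|) [set a | a = e]).
    by move=> y _; exact: nc.
  exact: closed_eq.
have [|c cS cmin] :=
  EVT_min_rV (f := fun y => f y + rho * P y) S0 Scomp _.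
  exact/continuous_subspaceT/continuous_penalty.
(* Since E_q and E_rho differ by [(q - rho) * P], a bound on the variation of [P] over the sphere
   makes their closeness uniform there. *)
have [|b bS bmax] := EVT_max_rV (f := fun y => `|P y - P x0|) S0 Scomp _.
  apply: continuous_subspaceT => y.
  apply: (@continuous_comp _ _ _ P (fun a => `|a - P x0|)); first exact: Pc.
  exact: norm_sub_continuous.
set delta := (f c + rho * P c) - (f x0 + rho * P x0).
set B := `|P b - P x0|.
(* A zero gap would make [c] a second minimizer of E_rho, at distance [e > 0] from [x0]. *)
have delta0 : 0 < delta.
  rewrite subr_gt0 lt_neqAle (xmin _ Irho c) andbT; apply/negP => /eqP E.
  have cm : minimizer (fun y => f y + rho * P y) c.
    by move=> y; rewrite -E; exact: xmin.
  have cx := strictly_convex_minimizer_unique (Ecv _ Irho) cm (xmin _ Irho).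
  by move: cS e0; rewrite inE /S/= cx subrr normr0 => <-; rewrite ltxx.
have B1 : 0 < B + 1 by rewrite ltr_wpDl /B.
near=> q; rewrite ltNge; apply/negP => exq.
have Iq : I q by near: q; exact: withinT.
have [z Sz] := step _ Iq exq.
apply/negP; rewrite -ltNge.
(* Replacing E_rho by E_q changes the increment from [x0] to [z], which is at least [delta], by at
   most [|rho - q| * B < delta], so it stays positive. The [+ 1] keeps the divisor nonzero when
   [B = 0]. *)
have qr : `|rho - q| < delta / (B + 1).
  near: q; apply: cvg_within; apply: nbhsx_ballx.
  by rewrite divr_gt0.
have zS : z \in S by rewrite inE.
have := cmin z zS; have := bmax z zS; rewrite -/B.
rewrite ltr_pdivlMr// in qr.
have : (rho - q) * (P z - P x0) <= `|rho - q| * `|P z - P x0|.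
  by rewrite -normrM ler_norm.
move=> h1 h2 h3.
have : `|rho - q| * `|P z - P x0| <= `|rho - q| * B by rewrite ler_wpM2l.
have := normr_ge0 (rho - q).
rewrite /delta in qr; lra.
Unshelve. all: by end_near. Qed.

End minimizers.

(** * The dot product on row vectors *)

Section dot.
Context {R : realType} {n : nat}.
Implicit Types (u v w : 'rV[R]_n).

Definition dot u v : R := (u *m v^T) 0 0.

Lemma dotE u v : dot u v = \sum_i u 0 i * v 0 i.
Proof. by rewrite /dot mxE; apply: eq_bigr => i _; rewrite mxE. Qed.

Lemma dotDl u v w : dot (u + v) w = dot u w + dot v w.
Proof. by rewrite /dot mulmxDl mxE. Qed.

Lemma dotZl (a : R) u v : dot (a *: u) v = a * dot u v.
Proof. by rewrite /dot -scalemxAl mxE. Qed.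

Lemma dotNl u v : dot (- u) v = - dot u v.
Proof. by rewrite /dot mulNmx mxE. Qed.

Lemma dotNr u v : dot u (- v) = - dot u v.
Proof. by rewrite /dot linearN mulmxN mxE. Qed.

Lemma dotBr u v w : dot u (v - w) = dot u v - dot u w.
Proof. by rewrite /dot linearB mulmxBr !mxE. Qed.

Lemma dotZr (a : R) u v : dot u (a *: v) = a * dot u v.
Proof. by rewrite /dot linearZ -scalemxAr mxE. Qed.

Lemma dot0l v : dot 0 v = 0.
Proof. by rewrite /dot mul0mx mxE. Qed.

Lemma dot_suml (J : finType) (P : pred J) (F : J -> 'rV[R]_n) v :
  dot (\sum_(k | P k) F k) v = \sum_(k | P k) dot (F k) v.
Proof. by rewrite /dot mulmx_suml summxE. Qed.

Lemma dot_sumr (J : finType) (P : pred J) u (F : J -> 'rV[R]_n) :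
  dot u (\sum_(k | P k) F k) = \sum_(k | P k) dot u (F k).
Proof. by rewrite /dot linear_sum mulmx_sumr summxE. Qed.

Lemma dot_inj u v : (forall w, dot u w = dot v w) -> u = v.
Proof.
move=> uv; apply/rowP => i; have := uv (delta_mx 0 i).
by rewrite /dot !trmx_delta -!colE !mxE.
Qed.

End dot.

(** * Linear independence of subfamilies, dual vectors and stability *)

Section independence.
Context {R : realType} {n : nat} {K : finType}.
Implicit Types (P : pred K) (v : K -> 'rV[R]_n).

(** The index type stays fixed and coefficients are supported on [P], so that the active set can
    vary without a change of type. *)
Definition independent P v := forall c : K -> R,
  (forall k, ~~ P k -> c k = 0) -> \sum_k c k *: v k = 0 -> forall k, c k = 0.

Lemma sub_independent P P' v :
  (forall k, P' k -> P k) -> independent P v -> independent P' v.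
Proof.
by move=> sP iv c c0; apply: iv => k Pk; apply: c0; apply: contra Pk; exact: sP.
Qed.

(** The matrix whose rows are the selected vectors is row free, hence has a right inverse; the
    columns of that inverse are the dual vectors. *)
Lemma dual_family P v : independent P v ->
  exists D : K -> 'rV[R]_n,
    forall k l, P k -> P l -> dot (v k) (D l) = (k == l)%:R.
Proof.
move=> iv; pose A := \matrix_(i < #|P|) v (enum_val i).
have /row_freeP[B AB] : row_free A.
  apply: inj_row_free => a aA.
  (* Extension of [a] by zero: the sum has one term for [k] in [P] and none otherwise. *)
  pose c k := \sum_(i < #|P| | enum_val i == k) a 0 i.
  have cE i : c (enum_val i) = a 0 i.
    rewrite /c (big_pred1 i)// => j /=.
    by rewrite (inj_eq enum_val_inj).
  have c0 k : ~~ P k -> c k = 0.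
    move=> Pk; rewrite /c big_pred0// => i.
    apply/negbTE; apply: contra Pk => /eqP <-.
    exact: enum_valP.
  apply/rowP => i; rewrite mxE -cE; apply: iv => //.
  rewrite (bigID P)/= [X in _ + X]big1 ?addr0; last first.
    by move=> k /c0 ->; rewrite scale0r.
  rewrite (big_enum_val (fun k => c k *: v k)) -[RHS]aA mulmx_sum_row.
  by apply: eq_bigr => j _; rewrite cE rowK.
pose D k : 'rV[R]_n := if insub k is Some k' then
    (col (enum_rank_in (valP (k' : {x | P x})) (val k')) B)^T else 0.
exists D => k l Pk Pl; rewrite /D insubT/= /dot trmxK.
set i := enum_rank_in _ _.
have Ei : enum_val i = l by rewrite /i enum_rankK_in.
have Ej : enum_val (enum_rank_in Pk k) = k by rewrite enum_rankK_in.
move: (enum_rank_in Pk k) Ej => j Ej.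
have -> : v k = row j A by rewrite rowK Ej.
have : (A *m B) j i = (j == i)%:R by rewrite AB mxE.
rewrite -Ei -Ej (inj_eq enum_val_inj) => <-.
by rewrite !mxE; apply: eq_bigr => a _; rewrite !mxE.
Qed.

(** Subtracting from [d] its components along the [D k] leaves a vector orthogonal to every selected
    [v k], hence to [w]. So both sides have the same pairing with every [d]. *)
Lemma dual_expansion P v (D : K -> 'rV[R]_n) w :
  (forall k l, P k -> P l -> dot (v k) (D l) = (k == l)%:R) ->
  (forall d, (forall k, P k -> dot (v k) d = 0) -> dot w d = 0) ->
  w = \sum_(k | P k) dot w (D k) *: v k.
Proof.
move=> vD wP; apply: dot_inj => d.
have := wP (d - \sum_(k | P k) dot (v k) d *: D k).
rewrite dotBr => E; move: E => /(_ _)/subr0_eq ->.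
  rewrite dot_sumr dot_suml; apply: eq_bigr => k _.
  by rewrite dotZl dotZr mulrC.
move=> k Pk; rewrite dotBr dot_sumr (bigD1 k)//= big1 ?addr0.
  by rewrite dotZr vD// eqxx mulr1 subrr.
by move=> l /andP[Pl lk]; rewrite dotZr vD// eq_sym (negbTE lk) mulr0.
Qed.

(** The pairings of the [V t k] with fixed vectors dual to the [v k] are close to the identity
    matrix, and a matrix this close to the identity admits no nontrivial relation between its
    rows. *)
Lemma independent_near {T : Type} (F : set_system T) {FF : Filter F}
    P v (V : T -> K -> 'rV[R]_n) :
  (forall k d, dot (V t k) d @[t --> F] --> dot (v k) d) ->
  independent P v -> \forall t \near F, independent P (V t).
Proof.
move=> Vv /dual_family[D vD].
(* Chosen so that [#|K|%:R * e = 1 - e < 1]; summing [cS] over [K] then gives [S <= (1 - e) * S],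
   which forces [S = 0]. *)
pose e : R := (#|K|.+1%:R)^-1.
have e0 : 0 < e by rewrite invr_gt0.
have Ve : \forall t \near F, forall kl : K * K,
    `|dot (v kl.1) (D kl.2) - dot (V t kl.1) (D kl.2)| < e.
  by apply: filter_forall => -[k l]; exact: cvgr_dist_lt (Vv k (D l)) _ e0.
near=> t.
have Vte : forall kl : K * K,
    `|dot (v kl.1) (D kl.2) - dot (V t kl.1) (D kl.2)| < e by near: t.
move=> c c0 cV.
(* The first pairing sum equals [c k] by duality; the second vanishes because [c] is a relation
   between the [V t l]. *)
have ck k : P k -> c k = \sum_l c l * (dot (v l) (D k) - dot (V t l) (D k)).
  move=> Pk.
  transitivity (\sum_l c l * dot (v l) (D k) - \sum_l c l * dot (V t l) (D k)).
    rewrite (bigD1 k)//= vD// eqxx mulr1 big1 ?addr0; last first.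
      move=> l lk; have [Pl|/c0 ->] := boolP (P l); last by rewrite mul0r.
      by rewrite vD// (negbTE lk) mulr0.
    suff -> : \sum_l c l * dot (V t l) (D k) = 0 by rewrite subr0.
    rewrite -[RHS](dot0l (D k)) -cV dot_suml.
    by apply: eq_bigr => l _; rewrite dotZl.
  by rewrite -sumrB; apply: eq_bigr => l _; rewrite mulrBr.
set S := \sum_l `|c l|.
have S0 : 0 <= S by apply: sumr_ge0.
have cS k : `|c k| <= e * S.
  have [Pk|/c0 ->] := boolP (P k); last by rewrite normr0 mulr_ge0// ltW.
  rewrite ck// (le_trans (ler_norm_sum _ _ _))// /S mulr_sumr.
  apply: ler_sum => l _; rewrite normrM mulrC ler_wpM2r//.
  by apply: ltW; exact: (Vte (l, k)).
have SS : S <= #|K|%:R * e * S.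
  rewrite {1}/S (le_trans (ler_sum _ (fun k _ => cS k)))//.
  by rewrite sumr_const -[X in X <= _]mulr_natl mulrA.
have S1 : S = 0.
  apply/eqP; rewrite eq_le S0 andbT.
  have : #|K|%:R * e = 1 - e.
    rewrite /e; have : (#|K|.+1%:R : R) != 0 by rewrite pnatr_eq0.
    by rewrite -natr1 => ?; field.
  move=> E; rewrite E in SS.
  rewrite leNgt; apply/negP => Sp.
  have := mulr_gt0 e0 Sp; lra.
move=> k; apply/eqP; rewrite -normr_le0 -S1 /S (bigD1 k)//= lerDl.
exact: sumr_ge0.
Unshelve. all: by end_near. Qed.

End independence.

(** * One-sided directional derivatives of smooth functions and hinges *)

Section directional.
Context {R : realType} {n : nat}.
Implicit Types (f : 'rV[R]_n -> R) (x v : 'rV[R]_n) (lo : R).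

Lemma derive_gradient f x v :
  differentiable f x -> 'D_v f x = dot (gradient f x) v.
Proof.
move=> df; rewrite deriveE// [in LHS](row_sum_delta v) linear_sum dotE.
by apply: eq_bigr => i _; rewrite linearZ/= mxE deriveE// mulrC.
Qed.

Lemma difference_quotient_cvg f x v : differentiable f x ->
  t^-1 * (f (x + t *: v) - f x) @[t --> 0^'+] --> dot (gradient f x) v.
Proof.
move=> df; rewrite -derive_gradient//.
have /cvg_dnbhs_at_right := @diff_derivable _ _ _ f x v df.
apply: cvg_trans; apply: near_eq_cvg; near=> t.
by rewrite /= [_ + x]addrC.
Unshelve. all: by end_near. Qed.

(* Both |v| (lo = -1) and max {0, v} (lo = 0) are of this form, so equality and
   inequality constraints make up a single finite family. *)
Definition hinge lo (v : R) : R := Num.max (lo * v) v.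

(** The right derivative of [hinge lo] along a curve with value [v] and velocity [dv], for
    [lo <= 1]. At the kink it is the hinge of the velocity, by positive homogeneity. *)
Definition hinge_derivative lo (v dv : R) : R :=
  if v < 0 then lo * dv else if 0 < v then dv else hinge lo dv.

Lemma hinge_le0 lo (v : R) : lo <= 1 -> v <= 0 -> hinge lo v = lo * v.
Proof. by move=> lo1 v0; apply/max_idPl; rewrite ler_niMl. Qed.

Lemma hinge_ge0 lo (v : R) : lo <= 1 -> 0 <= v -> hinge lo v = v.
Proof. by move=> lo1 v0; apply/max_idPr; rewrite ler_piMl. Qed.

Lemma hinge_continuous lo : continuous (hinge lo).
Proof.
move=> v; apply: (@continuous_max R R ( *%R lo) id v).
  exact: mulrl_continuous.
exact: cvg_id.
Qed.

Lemma along_right_cvg f x v : differentiable f x ->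
  f (x + t *: v) @[t --> 0^'+] --> f x.
Proof.
move=> df; have fq := @difference_quotient_cvg f x v df.
have id0 : t @[t --> (0 : R)^'+] --> (0 : R).
  by apply: cvg_at_right_filter; exact: cvg_id.
have fE : f x = f x + 0 * dot (gradient f x) v by rewrite mul0r addr0.
rewrite [X in _ --> X]fE.
apply: cvg_trans (cvgD (cvg_cst (f x)) (cvgM id0 fq)).
apply: near_eq_cvg; near=> t.
have t0 : 0 < t by near: t; exact: nbhs_right_gt.
rewrite -[LHS]/(f x + t * (t^-1 * (f (x + t *: v) - f x))).
by rewrite mulVKf ?gt_eqF// addrC subrK.
Unshelve. all: by end_near. Qed.

(** If [f x] is nonzero, its sign persists for small [t] and the hinge is linear there. If
    [f x = 0], positive homogeneity moves the factor [t^-1] inside the hinge, whose continuity gives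
    the limit. *)
Lemma hinge_quotient_cvg lo f x v : lo <= 1 -> differentiable f x ->
  t^-1 * (hinge lo (f (x + t *: v)) - hinge lo (f x)) @[t --> 0^'+] -->
    hinge_derivative lo (f x) (dot (gradient f x) v).
Proof.
move=> lo1 df; have fc := @along_right_cvg f x v df.
have fq := @difference_quotient_cvg f x v df.
rewrite /hinge_derivative; case: ltP => [fx0|]; last case: ltP => [fx0 _|].
- apply: cvg_trans (cvgM (cvg_cst lo) fq).
  apply: near_eq_cvg; near=> t.
  have ft : f (x + t *: v) < 0 by near: t; exact: cvgr_lt fc _ fx0.
  by rewrite !hinge_le0 ?(ltW fx0) ?(ltW ft)// /=; ring.
- apply: cvg_trans fq.
  apply: near_eq_cvg; near=> t.
  have ft : 0 < f (x + t *: v) by near: t; exact: cvgr_gt fc _ fx0.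
  by rewrite !hinge_ge0 ?(ltW fx0) ?(ltW ft).
move=> fx0 fx0'; have fx : f x = 0 by apply/eqP; rewrite eq_le fx0 fx0'.
have hq : hinge lo (t^-1 * (f (x + t *: v) - f x)) @[t --> 0^'+] -->
    hinge lo (dot (gradient f x) v).
  by apply: continuous_cvg fq; exact: hinge_continuous.
apply: cvg_trans hq; apply: near_eq_cvg; near=> t.
have t0 : 0 < t by near: t; exact: nbhs_right_gt.
rewrite /= fx subr0 {3}/hinge mulr0 maxxx subr0.
by rewrite /hinge maxr_pMr ?invr_ge0 ?(ltW t0)// mulrCA.
Unshelve. all: by end_near. Qed.

End directional.

(** * Existence, uniqueness and continuity of the stationarity coefficients *)

Section stationarity.
Context {R : realType} {n : nat} {K : finType}.
Context (f : 'rV[R]_n -> R) (u : K -> 'rV[R]_n -> R) (lo : K -> R).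
Context (f_diff : forall x, differentiable f x).
Context (u_diff : forall k x, differentiable (u k) x).
Context (lo_bound : forall k, -1 <= lo k <= 1).
Implicit Types (x d : 'rV[R]_n) (c : K -> R).

Definition hinge_penalty y : R := \sum_k hinge (lo k) (u k y).

(** For [l <= 1], membership of [a] in the subdifferential of [hinge l] at [v]. The values [l = -1]
    and [l = 0] give [eq_coefficient] and [ineq_coefficient]. *)
Definition multiplier l (v a : R) :=
  [/\ v < 0 -> a = l, v = 0 -> l <= a <= 1 & 0 < v -> a = 1].

Definition stationary rho x c :=
  0 = gradient f x + rho *: (\sum_k c k *: gradient (u k) x) /\
  forall k, multiplier (lo k) (u k x) (c k).

Definition regular x :=
  independent (fun k => u k x == 0) (fun k => gradient (u k) x).

Lemma multiplier_bound k v a : multiplier (lo k) v a -> `|a| <= 1.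
Proof.
have /andP[l1 l2] := lo_bound k.
case=> vn v0 vp; rewrite ler_norml.
by have [/vn ->|/vp ->|/v0 /andP[]] := ltgtP v 0; lra.
Qed.

(** The right-hand side is the limit of difference quotients of the penalized function at its
    minimizer, all nonnegative. *)
Lemma minimizer_directional rho x d :
  minimizer (fun y => f y + rho * hinge_penalty y) x ->
  0 <= dot (gradient f x) d +
       rho * \sum_k hinge_derivative (lo k) (u k x) (dot (gradient (u k) x) d).
Proof.
move=> xmin.
have lo1 k : lo k <= 1 by have /andP[] := lo_bound k.
have uq k := @hinge_quotient_cvg R n (lo k) (u k) x d (lo1 k) (u_diff k x).
have sq : \sum_k (t^-1 * (hinge (lo k) (u k (x + t *: d)) -
                          hinge (lo k) (u k x))) @[t --> 0^'+] -->
    \sum_k hinge_derivative (lo k) (u k x) (dot (gradient (u k) x) d).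
  by apply: cvg_big => //; exact: add_continuous.
have fq := @difference_quotient_cvg R n f x d (f_diff x).
apply: (cvgr_to_ge (cvgD fq (cvgM (cvg_cst rho) sq))); near=> t.
have t0 : 0 < t by near: t; exact: nbhs_right_gt.
rewrite -[leRHS]/(t^-1 * (f (x + t *: d) - f x) + rho * \sum_k
   (t^-1 * (hinge (lo k) (u k (x + t *: d)) - hinge (lo k) (u k x)))).
rewrite -mulr_sumr mulrCA -mulrDr mulr_ge0 ?invr_ge0 ?(ltW t0)//.
rewrite sumrB -!/(hinge_penalty _).
have := xmin (x + t *: d); lra.
Unshelve. all: by end_near. Qed.

(** The sign of an inactive constraint fixes its coefficient, so [c - c'] is supported on the active
    ones, where it is a relation between independent gradients. *)
Lemma stationary_unique rho x c c' : rho != 0 -> regular x ->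
  stationary rho x c -> stationary rho x c' -> forall k, c k = c' k.
Proof.
move=> rho0 xreg [cE cm] [cE' cm'] k; apply/eqP; rewrite -subr_eq0; apply/eqP.
move: k; apply: xreg => [k uk|].
  have [cn _ cp] := cm k; have [cn' _ cp'] := cm' k.
  have [v0|v0|v0] := ltgtP (u k x) 0; last by rewrite v0 eqxx in uk.
    by rewrite cn// cn'// subrr.
  by rewrite cp// cp'// subrr.
apply: (scalerI rho0); rewrite scaler0.
under eq_bigr do rewrite scalerBl.
rewrite sumrB scalerBr; apply/eqP; rewrite subr_eq0; apply/eqP.
by apply: (addrI (gradient f x)); rewrite -cE.
Qed.

Lemma stationary_exists rho x : 0 < rho -> regular x ->
  minimizer (fun y => f y + rho * hinge_penalty y) x ->
  exists c, stationary rho x c.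
Proof.
move=> rho0 xreg xmin; have [D vD] := dual_family xreg.
have lo1 k : lo k <= 1 by have /andP[] := lo_bound k.
pose act k := u k x == 0.
pose grad k := gradient (u k) x.
(* The coefficient forced on an inactive constraint by its sign. The vector [w] below is then what
   the active gradients have to sum to, after division by [rho]. *)
pose base k : R := if u k x < 0 then lo k else 1.
pose w := - (rho^-1 *: gradient f x + \sum_(k | ~~ act k) base k *: grad k).
(* This is [minimizer_directional] divided by [rho], with the smooth and inactive terms collected in
   [w]. *)
have wle d : dot w d <= \sum_(k | act k) hinge (lo k) (dot (grad k) d).
  have := minimizer_directional d xmin.
  rewrite (bigID act)/=.
  rewrite [X in _ + _ * (X + _)](eq_bigr
    (fun k => hinge (lo k) (dot (grad k) d))); last first.
    by move=> k /eqP uk; rewrite /hinge_derivative uk ltxx.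
  rewrite [X in _ + _ * (_ + X)](eq_bigr
    (fun k => base k * dot (grad k) d)); last first.
    move=> k uk; rewrite /hinge_derivative /base.
    case: ltP => // ge0; rewrite lt_neqAle eq_sym uk ge0 mul1r.
    by [].
  rewrite /w dotNl dotDl dotZl dot_suml.
  under [X in _ -> - (_ + X) <= _]eq_bigr do rewrite dotZl.
  set a := dot _ _; set b := \sum_(_ | act _) _; set e := \sum_(_ | _) _.
  move=> ge0.
  have : 0 <= rho^-1 * (a + rho * (b + e)) by rewrite mulr_ge0// invr_ge0 ltW.
  rewrite mulrDr mulKf ?gt_eqF//; lra.
(* Along such a direction every active hinge vanishes; [d] and [- d] give the two inequalities. *)
have worth d : (forall k, act k -> dot (grad k) d = 0) -> dot w d = 0.
  move=> gd; apply/eqP; rewrite eq_le; apply/andP; split.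
    rewrite (le_trans (wle d))// big1// => k /gd ->.
    by rewrite /hinge mulr0 maxxx.
  rewrite -oppr_le0 -dotNr (le_trans (wle _))// big1// => k /gd.
  by rewrite dotNr => ->; rewrite oppr0 /hinge mulr0 maxxx.
have wE := dual_expansion vD worth.
exists (fun k => if act k then dot w (D k) else base k); split.
  rewrite (bigID act)/=.
  rewrite (eq_bigr (fun k => dot w (D k) *: grad k)); last by move=> k ->.
  rewrite [X in _ + _ *: (_ + X)](eq_bigr
    (fun k => base k *: grad k)); last first.
    by move=> k /negbTE ->.
  rewrite -wE /w opprD addrNK scalerN scalerA divff ?gt_eqF// scale1r.
  by rewrite subrr.
move=> k; rewrite /act /base; split=> [v0|v0|v0].
- by rewrite v0 lt_eqF.
- rewrite v0 eqxx.
  have ak : act k by rewrite /act v0.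
  (* Along a multiple of [D k] only the hinge of [k] survives. The factor [-1] yields the lower
     bound [lo k], the factor [1] the upper bound [1]. *)
  have sum_dual e : (forall l, hinge (lo l) 0 = 0) ->
      \sum_(l | act l) hinge (lo l) (e * dot (grad l) (D k)) =
      hinge (lo k) e.
    move=> h0; rewrite (bigD1 k)//= vD// eqxx mulr1 big1 ?addr0//.
    by move=> l /andP[al lk]; rewrite vD// (negbTE lk) mulr0.
  have h0 l : hinge (lo l) 0 = 0 by rewrite hinge_ge0.
  apply/andP; split.
    have := wle (- D k).
    under eq_bigr do rewrite dotNr -mulN1r.
    rewrite sum_dual// hinge_le0 ?lerN10// dotNr mulrN1.
    by rewrite lerN2.
  have := wle (D k).
  under eq_bigr do rewrite -[dot _ _]mul1r.
  by rewrite sum_dual// hinge_ge0.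
- by rewrite gt_eqF// ltNge ltW.
Qed.

(** Constraints inactive at [x] stay inactive nearby, so the active set can only shrink, and the
    gradients indexed by the old active set remain independent. *)
Lemma regular_near {T : Type} (F : set_system T) {FF : Filter F}
    (y : T -> 'rV[R]_n) x :
  (forall k, u k (y t) @[t --> F] --> u k x) ->
  (forall k d, dot (gradient (u k) (y t)) d @[t --> F] -->
     dot (gradient (u k) x) d) ->
  regular x -> \forall t \near F, regular (y t).
Proof.
move=> uy gy /(independent_near gy) yreg.
have act : \forall t \near F, forall k, u k x != 0 -> u k (y t) != 0.
  apply: filter_forall => k; have [_|uk] := eqVneq (u k x) 0.
    by near=> t.
  by near=> t => _; near: t; exact: cvgr_neq0 (uy k) uk.
near=> t.
have actt : forall k, u k x != 0 -> u k (y t) != 0 by near: t.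
have : independent (fun k => u k x == 0) (fun k => gradient (u k) (y t)).
  by near: t.
by apply: sub_independent => k; apply: contraTT => /actt.
Unshelve. all: by end_near. Qed.

(* Pairing the stationarity condition with the vectors dual to the active
   gradients at the limit point isolates each active coefficient up to an error
   that vanishes since all coefficients lie in [-1, 1]. *)
Lemma stationary_cvg {T : Type} (F : set_system T) {FF : Filter F}
    (rho : T -> R) (rho0 : R) (y : T -> 'rV[R]_n) x (c : T -> K -> R) c0 :
  rho0 != 0 -> rho t @[t --> F] --> rho0 ->
  (forall d, dot (gradient f (y t)) d @[t --> F] --> dot (gradient f x) d) ->
  (forall k, u k (y t) @[t --> F] --> u k x) ->
  (forall k d, dot (gradient (u k) (y t)) d @[t --> F] -->
     dot (gradient (u k) x) d) ->
  regular x -> stationary rho0 x c0 ->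
  (\forall t \near F, stationary (rho t) (y t) (c t)) ->
  forall k, c t k @[t --> F] --> c0 k.
Proof.
move=> rho00 rhoc fc uc gc xreg st0 st.
have [D vD] := dual_family xreg.
(* The constraint keeps its strict sign, which forces the same coefficient at [y t] as at [x]. *)
have inactive k : u k x != 0 -> \forall t \near F, c t k = c0 k.
  have [_ /(_ k)[cn0 _ cp0]] := st0.
  rewrite neq_lt => /orP[v0|v0]; near=> t.
    have : u k (y t) < 0 by near: t; exact: cvgr_lt (uc k) _ v0.
    have [_ /(_ k)[cn _ _]] : stationary (rho t) (y t) (c t) by near: t.
    by move=> /cn ->; rewrite cn0.
  have : 0 < u k (y t) by near: t; exact: cvgr_gt (uc k) _ v0.
  have [_ /(_ k)[_ _ cp]] : stationary (rho t) (y t) (c t) by near: t.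
  by move=> /cp ->; rewrite cp0.
move=> k; have [uk|/inactive ck] := eqVneq (u k x) 0; last first.
  by apply: cvg_near_cst.
have err l : c t l * (rho t * dot (gradient (u l) (y t)) (D k) -
    rho0 * dot (gradient (u l) x) (D k)) @[t --> F] --> (0 : R).
  have e0 : rho t * dot (gradient (u l) (y t)) (D k) -
      rho0 * dot (gradient (u l) x) (D k) @[t --> F] --> (0 : R).
    rewrite -[X in _ --> X](subrr (rho0 * dot (gradient (u l) x) (D k))).
    by apply: cvgB; [apply: cvgM|exact: cvg_cst].
  apply/cvgr0Pnorm_le => e e_gt0; near=> t; rewrite normrM.
  have le_e : `|rho t * dot (gradient (u l) (y t)) (D k) -
      rho0 * dot (gradient (u l) x) (D k)| <= e.
    by near: t; exact: cvgr0_norm_le e0 _ e_gt0.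
  apply: le_trans le_e; rewrite ler_piMl//.
  have [_ /(_ l)/multiplier_bound//] : stationary (rho t) (y t) (c t).
  by near: t.
pose S t := \sum_l c t l * (rho t * dot (gradient (u l) (y t)) (D k) -
    rho0 * dot (gradient (u l) x) (D k)).
have S0 : S t @[t --> F] --> (0 : R).
  rewrite [X in _ --> X](_ : _ = \sum_(l : K) 0); last by rewrite big1.
  by apply: cvg_big => //; exact: add_continuous.
(* The contribution of the constraints inactive at [x]; it is the same constant for [c0] and,
   eventually, for [c t]. *)
pose B := \sum_(l | u l x != 0) c0 l * (rho0 * dot (gradient (u l) x) (D k)).
have split_sum (a : K -> R) : (forall l, u l x != 0 -> a l = c0 l) ->
    \sum_l a l * (rho0 * dot (gradient (u l) x) (D k)) = rho0 * a k + B.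
  move=> ac; rewrite (bigID (fun l => u l x == 0))/=; congr (_ + _); last first.
    by apply: eq_bigr => l ul; rewrite ac.
  rewrite (bigD1 k)/= ?uk// vD ?uk// eqxx mulr1 big1 ?addr0 1?mulrC//.
  by move=> l /andP[ul lk]; rewrite vD ?uk// (negbTE lk) !mulr0.
have pairing r z a : stationary r z a ->
    dot (gradient f z) (D k) +
      \sum_l a l * (r * dot (gradient (u l) z) (D k)) = 0.
  move=> [E _]; rewrite -[RHS](dot0l (D k)) {1}E dotDl dotZl dot_suml mulr_sumr.
  by congr (_ + _); apply: eq_bigr => l _; rewrite dotZl mulrCA.
(* The paired condition solved for [c0 k]. The summand [0] stands where [S t] occurs in the same
   formula for [c t k], so that the limit can be taken term by term. *)
have c0E : c0 k = - rho0^-1 * (dot (gradient f x) (D k) + 0 + B).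
  have := pairing _ _ _ st0; rewrite split_sum// => E.
  apply: (mulfI rho00); rewrite mulrA mulrN divff//; lra.
rewrite c0E.
apply: cvg_trans (cvgM (cvg_cst (- rho0^-1))
  (cvgD (cvgD (fc (D k)) S0) (cvg_cst B))).
apply: near_eq_cvg; near=> t.
rewrite -[LHS]/(- rho0^-1 * (dot (gradient f (y t)) (D k) + S t + B)).
have stt : stationary (rho t) (y t) (c t) by near: t.
have ct : forall l, u l x != 0 -> c t l = c0 l.
  near: t; apply: filter_forall => l.
  have [_|/inactive] := eqVneq (u l x) 0; first by near=> t.
  by apply: filterS => t ->.
have := pairing _ _ _ stt; have := split_sum _ ct => E1 E2.
apply: (mulfI rho00); rewrite mulrA mulrN divff//.
have : S t = \sum_l c t l * (rho t * dot (gradient (u l) (y t)) (D k)) -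
    \sum_l c t l * (rho0 * dot (gradient (u l) x) (D k)).
  by rewrite -sumrB; apply: eq_bigr => l _; rewrite mulrBr.
lra.
Unshelve. all: by end_near. Qed.

End stationarity.

(** * Continuity of pairings, affine functions, and freeness of sequences *)

Section regularity.
Context {R : realType} {n : nat}.

Lemma dot_continuous (d : 'rV[R]_n) : continuous (fun w => dot w d).
Proof.
rewrite (_ : (fun w => dot w d) = (fun w => \sum_i w 0 i * d 0 i)); last first.
  by apply/funext => w; rewrite dotE.
apply: continuous_big => [|i _ w]; first exact: add_continuous.
apply: (@continuous_comp _ _ _ (fun w : 'rV[R]_n => w 0 i) ( *%R^~ (d 0 i))).
  exact: coord_continuous.
exact: mulrr_continuous.
Qed.

(** The difference quotients of an affine function do not depend on the base point. *)
Lemma affine_gradient (g : 'rV[R]_n -> R) x y :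
  affine_function g -> gradient g x = gradient g y.
Proof.
move=> [a [b gE]].
have dg z w : g (w + z) - g z = (w *m a) 0 0.
  by rewrite !gE mulmxDl [in LHS]mxE; lra.
apply/rowP => i; rewrite !mxE /derive.
under eq_fun do rewrite /= dg.
by under [in RHS]eq_fun do rewrite /= dg.
Qed.

Lemma affine_differentiable (g : 'rV[R]_n -> R) x :
  affine_function g -> differentiable g x.
Proof.
move=> [a [b gE]].
rewrite (_ : g = \sum_i (fun y : 'rV[R]_n => y 0 i * a i 0) + cst b);
  last first.
  apply/funext => y; rewrite gE mxE /= fctE /=; congr (_ + _).
  by rewrite fct_sumE.
apply: differentiableD => //; apply: differentiable_sum => i.
apply: differentiableM => //; exact: differentiable_coord.
Qed.

Lemma affine_twice_differentiable (g : 'rV[R]_n -> R) :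
  affine_function g -> twice_differentiable g.
Proof.
move=> ga; split => x; first exact: affine_differentiable.
rewrite (_ : gradient g = cst (gradient g 0)); first exact: differentiable_cst.
by apply/funext => y; exact: affine_gradient.
Qed.

(** Translates freeness of a sequence into independence over an index type. As [L] has no
    repetitions, each index owns exactly one position, even if its vector occurs several times. *)
Lemma free_independent (K : finType) (L : seq K) (v : K -> 'rV[R]_n) :
  uniq L -> free [seq v k | k <- L] -> independent (fun k => k \in L) v.
Proof.
move=> Lu Lf c c0 cv k; have [kL|/c0//] := boolP (k \in L).
have /freeP Lf' : free (in_tuple [seq v k | k <- L]) by [].
have ik : (index k L < size [seq v k | k <- L])%N by rewrite size_map index_mem.
suff cL : \sum_(i < size [seq v k | k <- L])
    c (nth k L i) *: (in_tuple [seq v k | k <- L])`_i = 0.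
  by have := Lf' _ cL (Ordinal ik); rewrite /= nth_index.
rewrite -[RHS]cv [RHS](bigID (fun k => k \in L))/=.
rewrite [X in _ = _ + X]big1 ?addr0; last first.
  by move=> l /c0 ->; rewrite scale0r.
rewrite -big_uniq// (big_nth k) big_mkord size_map.
by apply: eq_bigr => i _; rewrite (nth_map k).
Qed.

End regularity.

(** * Equality and inequality constraints as one family *)

Section constraints.
Context {R : realType} {n r s : nat}.
Context (f : 'rV[R]_n -> R).
Context (g : 'I_r -> 'rV[R]_n -> R) (h : 'I_s -> 'rV[R]_n -> R).

Definition constraint (k : 'I_r + 'I_s) : 'rV[R]_n -> R :=
  match k with inl i => g i | inr j => h j end.

Definition constraint_lo (k : 'I_r + 'I_s) : R := if k is inl _ then -1 else 0.

Definition constraint_coef (sigma : 'rV[R]_r) (tau : 'rV[R]_s)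
    (k : 'I_r + 'I_s) : R :=
  match k with inl i => sigma 0 i | inr j => tau 0 j end.

Lemma constraint_lo_bound k : -1 <= constraint_lo k <= 1.
Proof. by case: k => i /=; lra. Qed.

Lemma penalizedE rho : penalized f g h rho =
  fun y => f y + rho * hinge_penalty constraint constraint_lo y.
Proof.
apply/funext => y; rewrite /penalized /hinge_penalty big_sumType/= mulrDr addrA.
congr (_ + rho * _ + rho * _); apply: eq_bigr => k _; rewrite /hinge.
  by rewrite mulN1r maxC maxrN.
by rewrite mul0r.
Qed.

Lemma stationarityE rho x sigma tau :
  stationarity_coefficients f g h rho x sigma tau <->
  stationary f constraint constraint_lo rho x (constraint_coef sigma tau).
Proof.
rewrite /stationary big_sumType/= scalerDr addrA; split.
  by case=> E es et; split => // -[].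
by case=> E st; split => // k; [exact: (st (inl k))|exact: (st (inr k))].
Qed.

Lemma free_regular x : free (active_gradients g h x) -> regular constraint x.
Proof.
(* The tagged active indices, in the order of [active_gradients]; tagging makes them distinct even
   when gradients coincide. *)
pose L : seq ('I_r + 'I_s) := [seq inl i | i <- enum 'I_r & g i x == 0] ++
  [seq inr j | j <- enum 'I_s & h j x == 0].
have -> : active_gradients g h x = [seq gradient (constraint k) x | k <- L].
  by rewrite map_cat -!map_comp.
have Lu : uniq L.
  have inl_inj : injective (@inl 'I_r 'I_s) by move=> ? ? [].
  have inr_inj : injective (@inr 'I_r 'I_s) by move=> ? ? [].
  rewrite cat_uniq !map_inj_uniq// !filter_uniq -?enumT ?enum_uniq//=.
  by rewrite andbT; apply/hasPn => _ /mapP[j _ ->]; apply/mapP => -[].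
move/(free_independent Lu); apply: sub_independent => -[i|j] /= k0.
  by rewrite mem_cat map_f// mem_filter k0 mem_enum.
by rewrite mem_cat orbC map_f// mem_filter k0 mem_enum.
Qed.

End constraints.

(** * Convergence along the solution path and assembly of the result *)

(** Supplies the convergence hypotheses of [regular_near] and [stationary_cvg]: both [u] and its
    gradient are differentiable, hence continuous. *)
Lemma twice_differentiable_path {R : realType} {n : nat} {T : Type}
    (F : set_system T) {FF : Filter F} (u : 'rV[R]_n -> R)
    (y : T -> 'rV[R]_n) x :
  twice_differentiable u -> y t @[t --> F] --> x ->
  u (y t) @[t --> F] --> u x /\
  (forall d, dot (gradient u (y t)) d @[t --> F] --> dot (gradient u x) d).
Proof.
move=> [u1 u2] yx; split=> [|d].
  by apply: continuous_cvg yx; exact: differentiable_continuous.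
apply: (@continuous_cvg _ _ _ _ _ _ (fun w => dot w d)).
  exact: dot_continuous.
by apply: continuous_cvg yx; exact: differentiable_continuous.
Qed.

Theorem proposition3p2 (R : realType) (n r s : nat)
    (f : 'rV[R]_n -> R)
    (g : 'I_r -> 'rV[R]_n -> R) (h : 'I_s -> 'rV[R]_n -> R)
    (I : set R)
    (f_convex : convex_function [set: 'rV[R]_n] f)
    (f_diff : twice_differentiable f)
    (h_convex : forall j, convex_function [set: 'rV[R]_n] (h j))
    (h_diff : forall j, twice_differentiable (h j))
    (g_affine : forall i, affine_function (g i))
    (I_interval : is_interval I)
    (I_ge0 : forall rho, I rho -> 0 <= rho)
    (E_strictly_convex : forall rho, I rho ->
       strictly_convex (penalized f g h rho))
    (E_coercive : forall rho, I rho -> coercive (penalized f g h rho)) :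
  (forall rho, I rho -> exists! x, minimizer (penalized f g h rho) x) /\
  (forall x : R -> 'rV[R]_n,
     (forall rho, I rho -> minimizer (penalized f g h rho) (x rho)) ->
     {within I, continuous x} /\
     (forall rho, I rho -> 0 < rho -> free (active_gradients g h (x rho)) ->
        exists2 U : set R, nbhs rho U &
        exists (sigma : R -> 'rV[R]_r) (tau : R -> 'rV[R]_s),
          [/\ forall q, (I `&` U) q ->
                stationarity_coefficients f g h q (x q) (sigma q) (tau q) /\
                (forall sigma' tau',
                   stationarity_coefficients f g h q (x q) sigma' tau' ->
                   sigma' = sigma q /\ tau' = tau q),
              forall i, {within I `&` U, continuous (fun q => sigma q 0 i)}
            & forall j, {within I `&` U, continuous (fun q => tau q 0 j)}])).
Proof.
pose K := ('I_r + 'I_s)%type.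
pose u : K -> 'rV[R]_n -> R := constraint g h.
pose lo : K -> R := @constraint_lo R r s.
pose P := hinge_penalty u lo.
have EE rho : penalized f g h rho = fun y => f y + rho * P y.
  exact: penalizedE.
have u_diff k : twice_differentiable (u k).
  case: k => [i|j]; last exact: h_diff.
  exact: affine_twice_differentiable (g_affine i).
have [f1 _] := f_diff.
have u1 k x : differentiable (u k) x by have [] := u_diff k.
have fc : continuous f by move=> y; exact: differentiable_continuous.
have Pc : continuous P.
  apply: continuous_big => [|k _ y]; first exact: add_continuous.
  apply: (@continuous_comp _ _ _ (u k) (hinge (lo k))).
    exact: differentiable_continuous.
  exact: hinge_continuous.
have Ecv rho : I rho -> strictly_convex (fun y => f y + rho * P y).
  by move=> Irho; rewrite -EE; exact: E_strictly_convex Irho.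
split=> [rho Irho|x xmin].
  have [|x xmin] := coercive_minimizer _ (E_coercive rho Irho).
    by rewrite EE; exact: continuous_penalty.
  exists x; split=> // y ymin.
  exact: strictly_convex_minimizer_unique (E_strictly_convex _ Irho) xmin ymin.
have xmin' rho : I rho -> minimizer (fun y => f y + rho * P y) (x rho).
  by move=> Irho; rewrite -EE; exact: xmin Irho.
have xc := minimizer_path_continuous fc Pc Ecv xmin'.
split=> // rho Irho rho0 /free_regular xreg.
have xcI q : I q -> x t @[t --> within I (nbhs q)] --> x q.
  by move: q; exact/subspace_continuousP.
(* The implication makes [U] a neighborhood in the whole line, although its condition is controlled
   only within [I]. *)
pose U := [set q | I q -> 0 < q /\ regular u (x q)].
exists U.
  suff : \forall q \near within I (nbhs rho), 0 < q /\ regular u (x q) by [].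
  near=> q; split.
    near: q; apply: cvg_within.
    exact: (cvgr_gt rho (@cvg_id _ (nbhs rho))).
  near: q; apply: regular_near xreg => k.
    exact: (twice_differentiable_path (u_diff k) (xcI _ Irho)).1.
  exact: (twice_differentiable_path (u_diff k) (xcI _ Irho)).2.
(* Coefficients are chosen for all [q] at once, with the default zero outside [I] and [U];
   continuity of the choice follows from [stationary_cvg]. *)
have /choice[c cP] q :
    exists c : K -> R, (I `&` U) q -> stationary f u lo q (x q) c.
  have [[Iq Uq]|nIU] := pselect ((I `&` U) q); last by exists (fun=> 0).
  have [q0 qreg] := Uq Iq.
  have [c cP] := stationary_exists f1 u1 (@constraint_lo_bound R r s) q0 qreg
    (xmin' _ Iq).
  by exists c.
have cc k : {within I `&` U, continuous (fun q => c q k)}.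
  apply/subspace_continuousP => q IUq; have [Iq Uq] := IUq.
  have [q0 qreg] := Uq Iq.
  have xq : x t @[t --> within (I `&` U) (nbhs q)] --> x q.
    apply: cvg_trans (xcI _ Iq); apply: cvg_app.
    by apply: within_subset => t [].
  move: k; apply: (stationary_cvg (f := f) (u := u) (lo := lo)
    (@constraint_lo_bound R r s) (rho := id) (rho0 := q) (y := x) (x := x q)).
  - by rewrite gt_eqF.
  - exact: cvg_within.
  - exact: (twice_differentiable_path f_diff xq).2.
  - by move=> k; exact: (twice_differentiable_path (u_diff k) xq).1.
  - by move=> k; exact: (twice_differentiable_path (u_diff k) xq).2.
  - exact: qreg.
  - exact: cP.
  - by near=> t; apply: cP; near: t; exact: withinT.
exists (fun q => \row_i c q (inl i)), (fun q => \row_j c q (inr j)).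
have coefE q : constraint_coef (\row_i c q (inl i)) (\row_j c q (inr j)) = c q.
  by apply/funext => -[i|j]; rewrite /= mxE.
split=> [q IUq|i|j].
- have [Iq Uq] := IUq; have [q0 qreg] := Uq Iq.
  split; first by apply/stationarityE; rewrite coefE; exact: cP.
  move=> sigma tau /stationarityE st.
  have E := stationary_unique (lt0r_neq0 q0) qreg st (cP q IUq).
  by split; apply/rowP => i; rewrite mxE -E.
- by under eq_fun do rewrite mxE; exact: cc.
- by under eq_fun do rewrite mxE; exact: cc.
Unshelve. all: by end_near. Qed.
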